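(* For every $d\le 20$, the $d$-dimensional cube $Q^d$ is stackable.
   Context: $Q^d$ has vertex set $\{0,1\}^d$, two vertices adjacent when they differ in exactly one coordinate. A configuration is a function $C:V(G)\to\mathbb{N}$ (numbers of cups). A cup stacking move from $u$ to $v$ is allowed when $C(u)\ge1$, $C(v)\ge1$ and $\mathrm{dist}_G(u,v)=C(u)$; it moves all cups of $u$ onto $v$. Let $\mathbf{1}$ be the configuration with one cup on every vertex. $G$ is $r$-stackable if some sequence of moves from $\mathbf{1}$ puts all cups on $r$, and stackable if it is $r$-stackable for every vertex $r$. *)

(* Defs.v *)
From Stdlib Require Import Relation_Operators.
From mathcomp Require Import all_boot.

Set Implicit Arguments.
Unset Strict Implicit.
Unset Printing Implicit Defensive.

(* A finite graph is given by its adjacency relation [e : rel V].  Distance is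
   a relation, so that vertices in different components are at no distance. *)
Definition is_dist (V : finType) (e : rel V) (u v : V) (n : nat) : Prop :=
  (exists p : seq V, [/\ path e u p, last u p = v & size p = n]) /\
  (forall p : seq V, path e u p -> last u p = v -> n <= size p).

Section CupStacking.
Variables (V : finType) (e : rel V).

Definition config := {ffun V -> nat}.

Definition ones : config := [ffun=> 1].

(* [allowed] forces [u != v], since [C u] is then a positive distance. *)
Definition move_cups (C : config) (u v : V) : config :=
  [ffun w => if w == u then 0 else if w == v then C u + C v else C w].

Definition allowed (C : config) (u v : V) : Prop :=
  [/\ 1 <= C u, 1 <= C v & is_dist e u v (C u)].

Definition cup_move (C C' : config) : Prop :=
  exists u v : V, allowed C u v /\ C' = move_cups C u v.

Definition all_on (r : V) (C : config) : Prop :=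
  forall w : V, w != r -> C w = 0.

Definition stackable_at (r : V) : Prop :=
  exists C : config, clos_refl_trans config cup_move ones C /\ all_on r C.

Definition stackable : Prop := forall r : V, stackable_at r.

End CupStacking.

Definition cube (d : nat) := {ffun 'I_d -> bool}.

Definition cube_adj (d : nat) : rel (cube d) :=
  fun x y => #|[set i | x i != y i]| == 1.

Lemma cube_adj_sym (d : nat) : symmetric (@cube_adj d).
Proof.
by move=> x y; rewrite /cube_adj; congr (#|pred_of_set _| == 1);
   apply/setP => i; rewrite !inE eq_sym.
Qed.

Lemma cube_adj_irr (d : nat) : irreflexive (@cube_adj d).
Proof.
move=> x; rewrite /cube_adj (_ : [set i | x i != x i] = set0) ?cards0 //.
by apply/setP => i; rewrite !inE eqxx.
Qed.

(* Main.v *)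
(** Call [Q^a] packable with offset [w] when the all-ones configuration can
    be turned into one in which every nonempty vertex [v] carries exactly
    [w + |v|] cups, [|v|] being the Hamming weight.  If [y] has weight [w],
    such a stacking played in the subcube [Q^a * {y}] leaves only piles whose
    height is their distance to the origin, so all of them can jump there.
    Hence packability with offset 0 gives stackability, and it propagates by
    splitting off one coordinate, since the two halves of [Q^(a+1)] with
    offset [w] are copies of [Q^a] with offsets [w] and [w + 1].
    Conversely, stackability of [Q^a] gathers [2^a] cups on any vertex, which
    is a packing with offset [w] whenever [w <= 2^a <= w + a].  These two rules
    and eight explicit stackings in [Q^4], [Q^5] and [Q^6] give packability of
    [Q^6] for all offsets up to 14, hence stackability up to dimension 20. *)

Require Import Defs.
From Stdlib Require Import Relation_Operators.
From mathcomp Require Import all_boot zify.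

Set Implicit Arguments.
Unset Strict Implicit.
Unset Printing Implicit Defensive.

(** * Stacking sequences in an arbitrary graph *)

Section Reach.
Variables (V : finType) (e : rel V).

Definition reach : config V -> config V -> Prop :=
  clos_refl_trans (config V) (cup_move e).

Lemma is_dist_uniq (u v : V) (m n : nat) :
  is_dist e u v m -> is_dist e u v n -> m = n.
Proof.
move=> [[p [pp lp sp]] minm] [[q [pq lq sq]] minn].
apply/eqP; rewrite eqn_leq -{1}sq minm //= -sp minn //.
Qed.

Lemma is_dist_refl (u : V) : is_dist e u u 0.
Proof. by split=> //; exists [::]. Qed.

Lemma allowed_neq (C : config V) (u v : V) : allowed e C u v -> u != v.
Proof.
case=> Cu _ duv; apply/eqP => uv; rewrite -uv in duv.
by rewrite (is_dist_uniq duv (is_dist_refl u)) in Cu.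
Qed.

Lemma reach_sum (C C' : config V) :
  reach C C' -> \sum_v C v = \sum_v C' v.
Proof.
elim=> [C1 C2 [u [v [ok ->]]] | // | C1 C2 C3 _ -> _ -> //].
have uv := allowed_neq ok; have vu : v != u by rewrite eq_sym.
rewrite (bigD1 u) // (bigD1 v) //= [RHS](bigD1 u) // [in RHS](bigD1 v) //=.
rewrite !ffunE !eqxx (negbTE vu) add0n addnA; congr (_ + _).
by apply: eq_bigr => w /andP[/negbTE wu /negbTE wv]; rewrite ffunE wu wv.
Qed.

(** Induction on the number of nonempty vertices other than [r]. A jump onto [r] changes no third
    pile, so the remaining piles stay at the right height; the pile on [r] only serves as a nonempty
    landing place. *)
Lemma reach_collect (r : V) (C : config V) : 0 < C r ->
  (forall v, v != r -> C v = 0 \/ is_dist e v r (C v)) ->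
  exists C', reach C C' /\ all_on r C'.
Proof.
have [n] := ubnP #|[set v | (v != r) && (0 < C v)]|; elim: n C => // n IHn C.
rewrite ltnS => leCn Cr dC.
have [/eqP none | [u]] := set_0Vmem [set v | (v != r) && (0 < C v)].
  exists C; split; first exact: rt_refl.
  move=> w wr; apply/eqP; rewrite -leqn0 leqNgt; apply/negP => Cw.
  by move/eqP/setP/(_ w): none; rewrite !inE wr Cw.
rewrite inE => /andP[ur Cu].
have du : is_dist e u r (C u) by case: (dC u ur) => // Cu0; rewrite Cu0 in Cu.
have ru : r == u = false by rewrite eq_sym (negbTE ur).
have [||w wr|C' [CC' C'r]] := IHn (move_cups C u r).
- apply: leq_trans leCn; apply: proper_card; apply/properP; split.
    apply/subsetP => w; rewrite !inE ffunE => /andP[wr].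
    by rewrite wr (negbTE wr); case: (w == u).
  by exists u; rewrite !inE ur // ffunE eqxx.
- by rewrite ffunE ru eqxx addn_gt0 Cr orbT.
- by rewrite ffunE (negbTE wr); case: eqP => _; [left | exact: dC].
exists C'; split=> //; apply: rt_trans CC'; apply: rt_step.
by exists u, r.
Qed.

End Reach.

(** Legality of a move depends only on two heights and a distance, so a sequence can be replayed in
    an isometric copy. The last clause lets disjoint copies be played one after the other. *)
Lemma reach_embed (V W : finType) (e : rel V) (e' : rel W) (f : V -> W)
    (C C' : config V) (D : config W) :
  injective f ->
  (forall u v n, is_dist e u v n -> is_dist e' (f u) (f v) n) ->
  reach e C C' -> (forall v, D (f v) = C v) ->
  exists D', [/\ reach e' D D', forall v, D' (f v) = C' v
               & forall w, (forall v, w <> f v) -> D' w = D w].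
Proof.
move=> f_inj f_dist CC'; elim: CC' D => {C C'}.
- move=> C C' [u [v [[Cu Cv duv] ->]]] D DC; exists (move_cups D (f u) (f v)).
  split.
  + by apply: rt_step; exists (f u), (f v); split=> //; split; rewrite !DC; auto.
  + by move=> w; rewrite !ffunE !(inj_eq f_inj) !DC.
  by move=> w wf; rewrite ffunE; do 2![case: eqP => [/wf // | _]].
- by move=> C D DC; exists D; split=> //; exact: rt_refl.
move=> C C1 C2 _ IH1 _ IH2 D /IH1[D1 [DD1 D1C out1]].
have [D2 [D12 D2C out2]] := IH2 D1 D1C.
exists D2; split=> // [|w wf]; first exact: rt_trans D12.
by rewrite out2 // out1.
Qed.

(** * Graph distance in the cube as Hamming distance *)

Section Hamming.
Variable d : nat.
Implicit Types x y z : cube d.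

Definition hamming x y := \sum_i (x i != y i).
Definition weight x := \sum_i x i.
Definition origin : cube d := [ffun=> false].
Definition cube_xor x y : cube d := [ffun i => x i (+) y i].

Lemma cube_adjE x y : cube_adj x y = (hamming x y == 1).
Proof. by rewrite /cube_adj -sum1dep_card big_mkcond. Qed.

Lemma hamming_eq0 x y : (hamming x y == 0) = (x == y).
Proof.
rewrite sum_nat_eq0; apply/forallP/eqP => [xy|-> i]; last by rewrite eqxx.
by apply/ffunP => i; have := xy i; rewrite eqb0 negbK => /eqP.
Qed.

Lemma hamming_triangle y x z : hamming x z <= hamming x y + hamming y z.
Proof.
rewrite -big_split; apply: leq_sum => i _.
by case: (x i) (y i) (z i) => [] [] [].
Qed.

Lemma hamming_xor x y z : hamming (cube_xor x z) (cube_xor y z) = hamming x y.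
Proof.
by apply: eq_bigr => i _; rewrite !ffunE; case: (x i) (y i) (z i) => [] [] [].
Qed.

Lemma hamming_origin x : hamming x origin = weight x.
Proof. by apply: eq_bigr => i _; rewrite ffunE; case: (x i). Qed.

Lemma cube_dist_hamming x y : is_dist (@cube_adj d) x y (hamming x y).
Proof.
split; last first.
  move=> p; elim: p x => [|z p IHp] x /= => [_ ->|/andP[xz pz] lz].
    by rewrite leqn0 hamming_eq0.
  apply: leq_trans (hamming_triangle z _ _) _.
  by move: xz; rewrite cube_adjE => /eqP->; rewrite ltnS IHp.
move: {-1}(hamming x y) (erefl (hamming x y)) => n.
elim: n x => [|n IHn] x xy.
  by exists [::]; split=> //; apply/eqP; rewrite -hamming_eq0 xy.
have [i xyi] : exists i, x i != y i.
  apply/existsP; apply: contra_eqT xy; rewrite negb_exists => /forallP same.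
  by rewrite /hamming big1 // => i _; have /negbTE -> := same i.
(* The first step of a geodesic corrects one coordinate where [x] and [y] differ. *)
pose z : cube d := [ffun j => if j == i then y j else x j].
have xz : hamming x z = 1.
  rewrite /hamming (bigD1 i) //= ffunE eqxx xyi big1 // => j /negbTE ji.
  by rewrite ffunE ji eqxx.
have zy : hamming z y = n.
  move: xy; rewrite /hamming (bigD1 i) //= xyi => -[<-].
  rewrite (bigD1 i) //= ffunE !eqxx /= add0n.
  by apply: eq_bigr => j /negbTE ji; rewrite ffunE ji.
have [p [pz lz sp]] := IHn z zy.
by exists (z :: p); split=> //=; rewrite ?sp ?pz // cube_adjE xz.
Qed.

Lemma cube_distP x y n : is_dist (@cube_adj d) x y n <-> hamming x y = n.
Proof.
by split=> [/(is_dist_uniq (cube_dist_hamming x y))|<-];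
  last exact: cube_dist_hamming.
Qed.

End Hamming.

Lemma isometry_dist (a b : nat) (f : cube a -> cube b) :
  (forall x y, hamming (f x) (f y) = hamming x y) ->
  forall x y n, is_dist (@cube_adj a) x y n ->
    is_dist (@cube_adj b) (f x) (f y) n.
Proof. by move=> iso_f x y n /cube_distP xy; apply/cube_distP; rewrite iso_f. Qed.

(** * Splitting off the first coordinate *)

Definition cube_cons (a : nat) (b : bool) (x : cube a) : cube a.+1 :=
  [ffun i => if unlift ord0 i is Some j then x j else b].

Section Cons.
Variable a : nat.
Implicit Types (b c : bool) (x y : cube a).

Lemma cube_cons0 b x : cube_cons b x ord0 = b.
Proof. by rewrite ffunE unlift_none. Qed.

Lemma cube_consS b x i : cube_cons b x (lift ord0 i) = x i.
Proof. by rewrite ffunE liftK. Qed.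

Lemma hamming_cons b c x y :
  hamming (cube_cons b x) (cube_cons c y) = (b != c) + hamming x y.
Proof.
rewrite /hamming big_ord_recl !cube_cons0; congr (_ + _).
by apply: eq_bigr => i _; rewrite !cube_consS.
Qed.

Lemma weight_cons b x : weight (cube_cons b x) = b + weight x.
Proof.
rewrite /weight big_ord_recl cube_cons0; congr (_ + _).
by apply: eq_bigr => i _; rewrite cube_consS.
Qed.

Lemma cube_cons_inj b c x y :
  cube_cons b x = cube_cons c y -> b = c /\ x = y.
Proof.
move/ffunP => eq_bc; split; first by have := eq_bc ord0; rewrite !cube_cons0.
by apply/ffunP => i; have := eq_bc (lift ord0 i); rewrite !cube_consS.
Qed.

Lemma cube_consP (z : cube a.+1) : exists b x, z = cube_cons b x.
Proof.
exists (z ord0), [ffun i => z (lift ord0 i)]; apply/ffunP => i.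
by rewrite ffunE; case: unliftP => [j|] ->; rewrite ?ffunE.
Qed.

End Cons.

(** * Packings and the two rules that produce them *)

(* At offset 0 the origin has no prescribed height: it is the final target and
   only has to be nonempty. *)
Definition packed (a w : nat) (C : config (cube a)) : Prop :=
  forall v, if w + weight v == 0 then 0 < C v
            else (C v == 0) || (C v == w + weight v).

Definition packable (a w : nat) : Prop :=
  exists C, reach (@cube_adj a) (ones (cube a)) C /\ packed w C.

Lemma packableS (a w : nat) :
  packable a w -> packable a w.+1 -> packable a.+1 w.
Proof.
move=> [C0 [reach0 packed0]] [C1 [reach1 packed1]].
have cons_inj b : injective (@cube_cons a b) by move=> x y /cube_cons_inj[].
have cons_dist b x y n : is_dist (@cube_adj a) x y n ->
    is_dist (@cube_adj a.+1) (cube_cons b x) (cube_cons b y) n.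
  by apply: isometry_dist => {x y} x y; rewrite hamming_cons eqxx.
have [v|D0 [oD0 D0C outD0]] := reach_embed (D := ones (cube a.+1))
  (cons_inj false) (@cons_dist false) reach0; first by rewrite !ffunE.
have diff b x c y : b != c -> cube_cons b x <> cube_cons c y :> cube a.+1.
  by move=> + /cube_cons_inj[bc]; rewrite bc eqxx.
(* The second half is played from [D0], which by [outD0] still has one cup on each of its
   vertices. *)
have [v|D1 [D01 D1C outD1]] := reach_embed (D := D0)
  (cons_inj true) (@cons_dist true) reach1.
  by rewrite outD0 ?ffunE // => x; apply: diff.
exists D1; split; first exact: rt_trans D01.
move=> z; have [[] [x ->]] := cube_consP z; rewrite weight_cons.
  by rewrite D1C addnA addn1; exact: packed1.
rewrite outD1 => [|y]; last exact: diff.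
by rewrite D0C; exact: packed0.
Qed.

Lemma packable_stackable (d : nat) : packable d 0 -> stackable (@cube_adj d).
Proof.
move=> [C [oneC packC]] r.
have w0 : weight (origin d) = 0 by rewrite /weight big1 // => i _; rewrite ffunE.
have [||C' [CC' C'0]] := @reach_collect _ (@cube_adj d) (origin d) C.
- by have := packC (origin d); rewrite w0.
- move=> v v0; have := packC v; rewrite add0n -hamming_origin hamming_eq0.
  rewrite (negbTE v0) => /orP[/eqP->|/eqP Cv]; [by left | right].
  exact/cube_distP/esym.
(* All cups are now on the origin; translation by [r] is an isometry carrying the origin to [r] and
   fixing the all-ones configuration. *)
have xorK : involutive (fun x => cube_xor x r).
  by move=> x; apply/ffunP => i; rewrite !ffunE addbK.
have [v|D [oneD DC _]] := reach_embed (D := ones (cube d)) (inv_inj xorK)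
  (isometry_dist (fun x y => hamming_xor x y r)) (rt_trans _ _ _ _ _ oneC CC').
  by rewrite !ffunE.
exists D; split=> // v vr; rewrite -(xorK v) DC C'0 //.
apply: contra_neq vr => vr0; rewrite -(xorK v) vr0.
by apply/ffunP => i; rewrite !ffunE.
Qed.

Lemma stackable_packable (a w : nat) : stackable (@cube_adj a) ->
  w <= 2 ^ a <= w + a -> packable a w.
Proof.
move=> stack_a /andP[lew leaw].
(* Since [a < 2 ^ a], the lower bound on [w + a] rules out offset 0. *)
have w_gt0 : 0 < w by have := ltn_expl a (ltnSn 1); lia.
(* A vertex of weight [2 ^ a - w], where a pile of all the cups has the prescribed height. *)
pose r : cube a := [ffun i : 'I_a => i < 2 ^ a - w].
have wr : w + weight r = 2 ^ a.
  rewrite /weight (eq_bigr (fun i : 'I_a => nat_of_bool (i < 2 ^ a - w))).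
    rewrite -big_mkcond -(big_ord_widen a (fun=> 1)); last by lia.
    by rewrite sum1_card card_ord subnKC.
  by move=> i _; rewrite ffunE.
have [C [oneC Cr]] := stack_a r.
exists C; split=> // v; rewrite addn_eq0 eqn0Ngt w_gt0 /=.
have [-> | vr] := eqVneq v r; last by rewrite Cr.
rewrite wr; apply/orP; right.
have := reach_sum oneC; rewrite [RHS](bigD1 r) //= [X in _ + X]big1 ?addn0 //.
move=> <-; rewrite (eq_bigr (fun=> 1)) => [|u _]; last by rewrite ffunE.
by rewrite sum1_card card_ffun card_bool card_ord.
Qed.

(** * Explicit packings *)

Fixpoint vertex (a n : nat) : cube a :=
  if a is a'.+1 then cube_cons (odd n) (vertex a' n./2) else origin 0.

Fixpoint digit_dist (a m n : nat) : nat :=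
  if a is a'.+1 then (odd m != odd n) + digit_dist a' m./2 n./2 else 0.

Lemma vertex_surj (a : nat) (x : cube a) : exists2 n, n < 2 ^ a & x = vertex a n.
Proof.
elim: a x => [|a IHa] x; first by exists 0 => //; apply/ffunP => -[].
have [b [y ->]] := cube_consP x; have [n ltn ->] := IHa y.
exists (b + n.*2); first by rewrite expnS; case: b; lia.
by rewrite /= oddD odd_double addbF half_bit_double; case: b.
Qed.

Lemma vertex_inj (a m n : nat) :
  m < 2 ^ a -> n < 2 ^ a -> vertex a m = vertex a n -> m = n.
Proof.
elim: a m n => [|a IHa] m n; first by rewrite expn0; lia.
rewrite expnS => ltm ltn /cube_cons_inj[odd_mn half_mn].
rewrite -(odd_double_half m) -(odd_double_half n) odd_mn.
by rewrite (IHa m./2 n./2) //; lia.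
Qed.

Lemma hamming_vertex (a m n : nat) :
  hamming (vertex a m) (vertex a n) = digit_dist a m n.
Proof.
elim: a m n => [|a IHa] m n /=; first by rewrite /hamming big_ord0.
by rewrite hamming_cons IHa.
Qed.

(** Tables of naturals replace finite functions so that a stacking can be checked by evaluation;
    [None] signals an illegal move. *)
Fixpoint play (a : nat) (c : seq nat) (ms : seq (nat * nat)) :
    option (seq nat) :=
  if ms is (u, v) :: ms' then
    let k := nth 0 c u in let l := nth 0 c v in
    (* [digit_dist] reads only [a] digits, so the bounds keep a larger number from aliasing a
       vertex. *)
    if [&& u < 2 ^ a, v < 2 ^ a, 0 < k, 0 < l & digit_dist a u v == k]
    then play a (set_nth 0 (set_nth 0 c v (k + l)) u 0) ms' else None
  else Some c.

Definition walk_moves (walks : seq (seq nat)) : seq (nat * nat) :=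
  flatten [seq zip s (behead s) | s <- walks].

(* Each walk is the itinerary of one growing pile; vertices are written as
   integers whose binary digits are the coordinates. *)
Definition is_packing (a w : nat) (walks : seq (seq nat)) : bool :=
  if play a (nseq (2 ^ a) 1) (walk_moves walks) is Some c then
    all (fun n => nth 0 c n \in [:: 0; w + digit_dist a n 0]) (iota 0 (2 ^ a))
  else false.

Definition table_of (a : nat) (c : seq nat) (C : config (cube a)) : Prop :=
  forall n, n < 2 ^ a -> C (vertex a n) = nth 0 c n.

Lemma play_reach (a : nat) (ms : seq (nat * nat)) (c c' : seq nat)
    (C : config (cube a)) : table_of c C -> play a c ms = Some c' ->
  exists C', reach (@cube_adj a) C C' /\ table_of c' C'.
Proof.
elim: ms c C => [|[u v] ms IHms] c C cC /=.
  by case=> <-; exists C; split=> //; exact: rt_refl.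
case: ifP => // /and5P[ltu ltv k_gt0 l_gt0 /eqP uv] played.
have [|C' [CC' c'C']] := IHms _ (move_cups C (vertex a u) (vertex a v)) _ played.
  move=> n ltn; rewrite ffunE !nth_set_nth /= nth_set_nth /= !cC //.
  have vE m : m < 2 ^ a -> (vertex a n == vertex a m) = (n == m).
    by move=> ltm; apply/eqP/eqP => [/vertex_inj-> | ->].
  by rewrite !vE.
exists C'; split=> //; apply: rt_trans CC'; apply: rt_step.
exists (vertex a u), (vertex a v); split=> //; split; rewrite ?cC //.
by apply/cube_distP; rewrite hamming_vertex.
Qed.

Lemma vertex0 (a : nat) : vertex a 0 = origin a.
Proof.
elim: a => [|a IHa] //=; rewrite IHa; apply/ffunP => i.
by rewrite !ffunE; case: unlift => // j; rewrite ffunE.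
Qed.

Lemma packing_packable (a w : nat) (walks : seq (seq nat)) :
  0 < w -> is_packing a w walks -> packable a w.
Proof.
move=> w_gt0; rewrite /is_packing; case played: play => [c|] // /allP pack_c.
have [|C [oneC cC]] := play_reach (C := ones (cube a)) _ played.
  by move=> n ltn; rewrite ffunE nth_nseq ltn.
exists C; split=> // v; rewrite addn_eq0 eqn0Ngt w_gt0 /=.
have [n ltn ->] := vertex_surj v; have := pack_c n.
rewrite mem_iota ltn -hamming_vertex vertex0 hamming_origin cC // !inE.
exact.
Qed.

(** Splitting fails for offsets 3 and 4 in $Q^4$, as it needs offset 4 in $Q^3$. That is impossible:
    8 cups would form two piles of height 4, but only the origin may have that height. *)
Lemma packable_4_3 : packable 4 3.
Proof.
by apply: (packing_packable (walks :=
  [:: [:: 0; 2; 11; 12; 3]; [:: 14; 10; 6; 1]; [:: 5; 7; 4; 15];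
      [:: 9; 13; 8; 15]])); last by vm_compute.
Qed.

Lemma packable_4_4 : packable 4 4.
Proof.
by apply: (packing_packable (walks :=
  [:: [:: 1; 5; 12; 11; 4]; [:: 9; 8; 14; 0]; [:: 2; 10; 3; 13];
      [:: 7; 15; 6; 13]])); last by vm_compute.
Qed.

(** Offsets 7 to 10 in $Q^5$ cannot be split: offsets 8 to 11 are impossible in $Q^4$, where one
    pile has at most 15 cups and two have at least 17. *)
Lemma packable_5_7 : packable 5 7.
Proof.
by apply: (packing_packable (walks :=
  [:: [:: 8; 10; 0; 22; 1]; [:: 7; 6; 12; 31; 2]; [:: 19; 3; 5; 14; 16];
      [:: 21; 23; 18; 11; 4]; [:: 28; 20; 17; 2]; [:: 13; 15; 27; 16];
      [:: 26; 30; 29; 4]; [:: 25; 9; 24; 1]])); last by vm_compute.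
Qed.

Lemma packable_5_8 : packable 5 8.
Proof.
by apply: (packing_packable (walks :=
  [:: [:: 9; 25; 8; 6; 27]; [:: 24; 28; 21; 15; 0]; [:: 17; 16; 4; 18; 29];
      [:: 23; 7; 1; 20; 27]; [:: 5; 13; 11; 29]; [:: 12; 14; 31; 10; 29];
      [:: 3; 19; 26; 0]; [:: 30; 22; 2; 27]])); last by vm_compute.
Qed.

Lemma packable_5_9 : packable 5 9.
Proof.
by apply: (packing_packable (walks :=
  [:: [:: 18; 19; 2; 9; 6]; [:: 8; 12; 10; 1; 14]; [:: 3; 11; 7; 30; 0];
      [:: 5; 13; 25; 15; 0]; [:: 4; 20; 24; 21; 14]; [:: 17; 16; 26; 6];
      [:: 22; 23; 27; 14]; [:: 29; 31; 28; 6]])); last by vm_compute.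
Qed.

Lemma packable_5_10 : packable 5 10.
Proof.
by apply: (packing_packable (walks :=
  [:: [:: 25; 9; 29; 19; 8]; [:: 21; 17; 3; 26; 1]; [:: 16; 24; 10; 22; 8];
      [:: 6; 14; 2; 30; 0]; [:: 7; 23; 18; 1]; [:: 31; 15; 12; 1];
      [:: 27; 11; 8]; [:: 5; 13; 28; 0]; [:: 4; 20; 0]])); last by vm_compute.
Qed.

(** Offsets 10 and 11 in $Q^6$ would split through offset 11 in $Q^5$, which is impossible: two
    piles hold at most 31 of the 32 cups and three at least 35. *)
Lemma packable_6_10 : packable 6 10.
Proof.
by apply: (packing_packable (walks :=
  [:: [:: 16; 20; 23; 25; 50]; [:: 2; 0; 3; 21; 8]; [:: 12; 28; 14; 18; 63];
      [:: 56; 24; 30; 47; 26]; [:: 6; 22; 7; 36; 63]; [:: 41; 57; 17; 4; 26];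
      [:: 37; 45; 9; 19; 8]; [:: 35; 33; 5; 44; 50]; [:: 13; 15; 46; 31; 1];
      [:: 52; 60; 29; 49; 26]; [:: 55; 53; 39; 59; 1]; [:: 51; 50];
      [:: 61; 63]; [:: 38; 54; 63]; [:: 43; 11; 42; 48; 63];
      [:: 62; 58; 27; 50]; [:: 10; 8]; [:: 34; 32; 1]; [:: 40; 8]]));
  last by vm_compute.
Qed.

Lemma packable_6_11 : packable 6 11.
Proof.
by apply: (packing_packable (walks :=
  [:: [:: 4; 20; 0; 21; 59]; [:: 2; 3; 34; 56; 1]; [:: 38; 36; 53; 35; 16];
      [:: 22; 18; 48; 55; 1]; [:: 14; 46; 63; 52; 59]; [:: 62; 58; 54; 7; 59];
      [:: 25; 57; 40; 50; 8]; [:: 31; 23; 39; 42; 16]; [:: 37; 5; 6; 26; 32];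
      [:: 19; 17; 51; 61; 8]; [:: 49; 33; 45; 32]; [:: 44; 12; 30; 11; 32];
      [:: 13; 29; 60; 59]; [:: 28; 24; 10; 1]; [:: 41; 9; 15; 8];
      [:: 47; 43; 27; 16]])); last by vm_compute.
Qed.

(** * Available offsets in dimensions 0 to 6, and the climb to dimension 20 *)

Lemma packable_0 (w : nat) : w <= 1 -> packable 0 w.
Proof.
move=> lew; exists (ones (cube 0)); split; first exact: rt_refl.
by move=> v; rewrite /weight big_ord0 ffunE addn0; case: w lew => [|[|w]].
Qed.

Lemma packable_1 (w : nat) : w <= 2 -> packable 1 w.
Proof.
(* Offset 0 comes first, by splitting; the resulting stackability then supplies the largest offsets.
   The same pattern serves up to dimension 4. *)
have P0 : packable 1 0 by apply: packableS; apply: packable_0.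
case: w => [|w] // lew.
by apply: stackable_packable (packable_stackable P0) _; lia.
Qed.

Lemma packable_2 (w : nat) : w <= 4 -> packable 2 w.
Proof.
have P0 : packable 2 0 by apply: packableS; apply: packable_1.
case: w => [|[|w]] // lew; first by apply: packableS; apply: packable_1.
by apply: stackable_packable (packable_stackable P0) _; lia.
Qed.

Lemma packable_3 (w : nat) : w <= 8 -> w != 4 -> packable 3 w.
Proof.
have P0 : packable 3 0 by apply: packableS; apply: packable_2.
have [ltw4 _ _ | lew4 lew8 neqw4] := ltnP w 4.
  by apply: packableS; apply: packable_2; lia.
by apply: stackable_packable (packable_stackable P0) _; lia.
Qed.

Lemma packable_4 (w : nat) : (w <= 7) || (12 <= w <= 16) -> packable 4 w.
Proof.
have P0 : packable 4 0 by apply: packableS; apply: packable_3.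
have [-> _|neqw3] := eqVneq w 3; first exact: packable_4_3.
have [-> _|neqw4] := eqVneq w 4; first exact: packable_4_4.
have [lew7 _ | ltw7 lew16] := leqP w 7.
  by apply: packableS; apply: packable_3; lia.
by apply: stackable_packable (packable_stackable P0) _; lia.
Qed.

Lemma packable_5 (w : nat) : w <= 15 -> w != 11 -> packable 5 w.
Proof.
have [-> _ _|neqw7] := eqVneq w 7; first exact: packable_5_7.
have [-> _ _|neqw8] := eqVneq w 8; first exact: packable_5_8.
have [-> _ _|neqw9] := eqVneq w 9; first exact: packable_5_9.
have [-> _ _|neqw10 lew15 neqw11] := eqVneq w 10; first exact: packable_5_10.
by apply: packableS; apply: packable_4; lia.
Qed.

Lemma packable_6 (w : nat) : w <= 14 -> packable 6 w.
Proof.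
have [-> _|neqw10] := eqVneq w 10; first exact: packable_6_10.
have [-> _|neqw11 lew14] := eqVneq w 11; first exact: packable_6_11.
by apply: packableS; apply: packable_5; lia.
Qed.

(** Each added coordinate lowers the largest available offset by one; [k = 14] leaves only offset 0,
    in dimension 20. *)
Lemma packable_ge6 (k w : nat) : w + k <= 14 -> packable (k + 6) w.
Proof.
elim: k w => [|k IHk] w lewk; first by apply: packable_6; lia.
by apply: packableS; apply: IHk; lia.
Qed.

Theorem theorem8 (d : nat) (hd : d <= 20) : stackable (@cube_adj d).
Proof.
apply: packable_stackable; have [le6d | ltd6] := leqP 6 d.
  by rewrite -(subnK le6d); apply: packable_ge6; lia.
case: d ltd6 {hd} => [|[|[|[|[|[|d]]]]]] // _.
- exact: packable_0.
- exact: packable_1.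
- exact: packable_2.
- exact: packable_3.
- exact: packable_4.
- exact: packable_5.
Qed.
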